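(* Let $m_1,m_2\in[0,1]$ with $m_1m_2<1$. Let $G_1,G_2$ be independent $\{0,1\}$-valued random variables with $P(G_i=1)=m_i$, and let $F$ be a fair coin (a $\{0,1\}$-valued random variable with $P(F=1)=1/2$) independent of $(G_1,G_2)$. Then, conditionally on the event $G_1G_2=0$: (i) the probability that $G_1=1$ and $G_2=0$ is $$\mathrm{bel}=\frac{m_1(1-m_2)}{1-m_1m_2};$$ (ii) the probability that either ($G_1=1$ and $G_2=0$) or ($G_1=0$ and $G_2=0$) is $$\mathrm{pl}=1-\frac{m_2(1-m_1)}{1-m_1m_2};$$ (iii) the probability that either ($G_1=1$ and $G_2=0$) or ($G_1=G_2=0$ and $F=1$) is $$\mathrm{BetP}=\mathrm{bel}+\frac{\mathrm{pl}-\mathrm{bel}}{2}.$$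
   Context: Source 1 supports a claim and source 2 opposes it; $G_i=1$ means that source $i$ has decisive evidence (and is then correct). Conditioning on $G_1G_2=0$ excludes the contradictory case that both are decisive. The quantities $\mathrm{bel}$, $\mathrm{pl}$, $\mathrm{BetP}$ are the Dempster--Shafer belief (lower probability), plausibility (upper probability) and pignistic probability of the claim when source 1 assigns mass $m_1$ to ''true'' and the rest to ignorance, and source 2 assigns mass $m_2$ to ''false'' and the rest to ignorance. *)

(* Defs.v *)
From HB Require Import structures.
From mathcomp Require Import all_boot all_order all_algebra.
From mathcomp Require Import all_classical all_reals all_analysis.

Set Implicit Arguments.
Unset Strict Implicit.
Unset Printing Implicit Defensive.

Import Order.TTheory GRing.Theory Num.Theory.
Local Open Scope ring_scope.

Definition indep_rv (d d1 d2 : measure_display) (T : measurableType d)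
    (T1 : measurableType d1) (T2 : measurableType d2) (R : realType)
    (P : probability T R) (X : T -> T1) (Y : T -> T2) : Prop :=
  forall (A : set T1) (B : set T2), measurable A -> measurable B ->
    P ((X @^-1` A) `&` (Y @^-1` B))%classic
      = (P (X @^-1` A)%classic * P (Y @^-1` B)%classic)%E.

(* P(A | E), meaningful only when P(E) > 0; the value is 0 when P(E) = 0. *)
Definition cond_prob (d : measure_display) (T : measurableType d)
    (R : realType) (P : probability T R) (A E : set T) : R :=
  fine (P (A `&` E)%classic) / fine (P E).

(* In Dempster-Shafer theory on a finite frame T, a mass assignment is a
   function {set T} -> R, nonnegative, of total 1 and null at the empty set.
   The mass of the whole frame is that of ignorance. *)
Section DempsterShafer.
Context {R : realType} {T : finType}.
Implicit Types (m : {set T} -> R) (A B C : {set T}).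

(* Mass s on A and the rest on ignorance (so everything if A is the whole frame). *)
Definition simple_support A (s : R) : {set T} -> R :=
  fun B => s *+ (B == A) + (1 - s) *+ (B == [set: T]%SET).

Definition conflict m m' : R :=
  \sum_(B : {set T}) \sum_(C : {set T} | B :&: C == finset.set0) m B * m' C.

(* Dempster's rule of combination, meaningful only if the conflict is not 1. *)
Definition dempster m m' : {set T} -> R :=
  fun A => if A == finset.set0 then 0 else
    (\sum_(B : {set T}) \sum_(C : {set T} | B :&: C == A) m B * m' C)
      / (1 - conflict m m').

Definition bel m A : R :=
  \sum_(B : {set T} | (B != finset.set0) && (B \subset A)) m B.

Definition pl m A : R :=
  \sum_(B : {set T} | B :&: A != finset.set0) m B.

(* The pignistic probability shares each mass m B equally between the points
   of B. *)
Definition betp m A : R :=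
  \sum_(B : {set T} | B != finset.set0) m B * #|B :&: A|%:R / #|B|%:R.

End DempsterShafer.

(* The frame is bool: the hypothesis true says that the claim holds. *)
Definition claim : {set bool} := [set true]%SET.
Definition negated_claim : {set bool} := [set false]%SET.

Definition combined_mass {R : realType} (m1 m2 : R) : {set bool} -> R :=
  dempster (simple_support claim m1) (simple_support negated_claim m2).

(* Main.v *)
Require Import Defs.
From HB Require Import structures.
From mathcomp Require Import all_boot all_order all_algebra.
From mathcomp Require Import all_classical all_reals all_analysis.
From mathcomp Require Import ring.

Import Order.TTheory GRing.Theory Num.Theory.
Local Open Scope classical_set_scope.
Local Open Scope ring_scope.

(** The law of (G1, G2, F) is the product of three Bernoulli laws. Given
    G1 G2 = 0, the outcomes (1,0), (0,1) and (0,0) of (G1, G2) carry exactly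
    the masses that Dempster's rule gives to "true", "false" and ignorance, and
    the fair coin splits ignorance evenly, as the pignistic probability does. *)

(** A subset of the frame is two membership bits; in this form [inE] decides every comparison met
    below. *)
Lemma set_bool_eqE (A B : {set bool}) :
  (A == B) = ((true \in A) == (true \in B)) && ((false \in A) == (false \in B)).
Proof.
apply/eqP/andP => [->|[/eqP hT /eqP hF]]; first by rewrite !eqxx.
by apply/setP => -[].
Qed.

Lemma subset_boolE (A B : {set bool}) :
  (A \subset B)
    = ((true \in A) ==> (true \in B)) && ((false \in A) ==> (false \in B)).
Proof.
apply/fintype.subsetP/andP => [AB|[/implyP hT /implyP hF] []//].
by split; apply/implyP; exact: AB.
Qed.

Lemma card_set_boolE (A : {set bool}) :
  #|A| = ((true \in A) + (false \in A))%N.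
Proof. by rewrite -sum1_card big_mkcond big_bool /=; do 2!case: (_ \in A). Qed.

(** The frame has only four subsets, so every sum over masses becomes an explicit expression. *)
Lemma big_set_bool (V : nmodType) (f : {set bool} -> V) :
  \sum_(A : {set bool}) f A
    = f finset.set0 + f claim + f negated_claim + f [set: bool]%SET.
Proof.
rewrite (bigD1 finset.set0)//= (bigD1 claim) /=; last first.
  by rewrite set_bool_eqE !inE.
rewrite (bigD1 negated_claim) /=; last by rewrite !set_bool_eqE !inE.
rewrite (bigD1 [set: bool]%SET) /=; last by rewrite !set_bool_eqE !inE.
rewrite big1 ?addr0 ?addrA// => A; rewrite !set_bool_eqE !inE.
by do 2!case: (_ \in A).
Qed.

Section CombinedMass.
Context {R : realType} (m1 m2 : R).

(** Among the sets carrying mass, only [claim] and [negated_claim] are disjoint. *)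
Lemma conflict_simple_support :
  conflict (simple_support claim m1) (simple_support negated_claim m2)
    = m1 * m2.
Proof.
rewrite /conflict /simple_support; under eq_bigr do rewrite big_mkcond big_set_bool.
by rewrite big_set_bool !set_bool_eqE !inE /= ?mulr1n ?mulr0n; ring.
Qed.

Lemma combined_massE (A : {set bool}) :
  combined_mass m1 m2 A
    = (m1 * (1 - m2) *+ (A == claim) + m2 * (1 - m1) *+ (A == negated_claim)
       + (1 - m1) * (1 - m2) *+ (A == [set: bool]%SET)) / (1 - m1 * m2).
Proof.
rewrite /combined_mass /dempster conflict_simple_support /simple_support.
under eq_bigr do rewrite big_mkcond big_set_bool.
rewrite big_set_bool !set_bool_eqE !inE.
(* The two bits of [A] give four cases. For the empty set both sides vanish; in the others the
   unnormalised masses agree. *)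
by case: (true \in A); case: (false \in A); rewrite /= ?mulr1n ?mulr0n;
  rewrite ?mul0r ?addr0 ?mul0r//; congr (_ / _); ring.
Qed.

Lemma bel_claimE :
  bel (combined_mass m1 m2) claim = m1 * (1 - m2) / (1 - m1 * m2).
Proof.
rewrite /bel big_mkcond big_set_bool !combined_massE.
by rewrite !subset_boolE !set_bool_eqE !inE /= ?mulr1n ?mulr0n; ring.
Qed.

Lemma pl_claimE :
  pl (combined_mass m1 m2) claim
    = (m1 * (1 - m2) + (1 - m1) * (1 - m2)) / (1 - m1 * m2).
Proof.
rewrite /pl big_mkcond big_set_bool !combined_massE.
by rewrite !set_bool_eqE !inE /= ?mulr1n ?mulr0n; ring.
Qed.

Lemma betp_claimE :
  betp (combined_mass m1 m2) claim
    = (m1 * (1 - m2) + (1 - m1) * (1 - m2) / 2) / (1 - m1 * m2).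
Proof.
rewrite /betp big_mkcond big_set_bool !combined_massE.
rewrite !card_set_boolE !set_bool_eqE !inE /= ?mulr1n ?mulr0n ?addn0 ?add0n.
(* Nothing here makes [1 - m1 * m2] nonzero, so its inverse is made an opaque factor and [field]
   only has to invert 2. *)
by move: (1 - m1 * m2)^-1 => q; field.
Qed.

End CombinedMass.

Section FiniteValued.
Context (R : realType) (d : measure_display) (T : measurableType d)
  (P : probability T R).

(** The event is the finite disjoint union of the fibres of [X] over the values in [A], so
    additivity applies. *)
Lemma probability_preimage_finType (K : finType) (X : T -> K) (A : {pred K}) :
  (forall k, measurable (X @^-1` [set k])) ->
  P [set w | A (X w)] = (\sum_(k | A k) P (X @^-1` [set k]))%E.
Proof.
(* The sum is recast as one over a finite set, the form in which [measure_fin_bigcup] states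
   additivity. *)
move=> mX; rewrite (bigfs _ (index_enum_uniq K)); last first.
  by move=> k _; rewrite mem_index_enum.
rewrite -measure_fin_bigcup//.
- congr (P _); apply/seteqP; split => [w AXw|w [k /= Ak Xk]].
    by exists (X w).
  by rewrite /= Xk.
- by move=> j k _ _ [w [<- <-]].
Qed.

Lemma probability_fiber_bool (X : {RV P >-> bool}) (m : R) (b : bool) :
  P [set w | X w = true] = m%:E ->
  P (X @^-1` [set b]) = (if b then m else 1 - m)%:E.
Proof.
case: b => //= PX; rewrite EFinB -PX -probability_setC.
  by congr (P _); apply/seteqP; split => w /=; case: (X w).
exact: (@measurable_funPTI _ _ _ _ X [set true]).
Qed.

End FiniteValued.

Arguments probability_fiber_bool {R d T P X m} b.

Section TwoSourcesAndCoin.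
Context (R : realType) (d : measure_display) (T : measurableType d)
  (P : probability T R) (m1 m2 p : R) (G1 G2 F : {RV P >-> bool}).
Hypotheses (PG1 : P [set w | G1 w = true] = m1%:E)
  (PG2 : P [set w | G2 w = true] = m2%:E)
  (PF : P [set w | F w = true] = p%:E)
  (indepG : indep_rv P G1 G2)
  (indepF : indep_rv P F (fun w => (G1 w, G2 w))).

(** Any event in the three variables is a union of atoms, and the probability of each atom factors:
    first [F] splits off from the pair, then [G1] from [G2]. *)
Lemma fine_probability_sources_coin (A : bool -> bool -> bool -> bool) :
  fine (P [set w | A (G1 w) (G2 w) (F w)])
    = \sum_(a : bool) \sum_(b : bool) \sum_(c : bool)
        ((if a then m1 else 1 - m1) * (if b then m2 else 1 - m2)
          * (if c then p else 1 - p)) *+ A a b c.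
Proof.
pose X w := (G1 w, G2 w, F w).
have fiberE a b c : X @^-1` [set (a, b, c)]
    = (F @^-1` [set c]) `&` ((fun w => (G1 w, G2 w)) @^-1` [set (a, b)]).
  by apply/seteqP; split => w /= [] => [-> -> ->|Fc [Ga Gb]] //; rewrite /X Fc Ga Gb.
have fiber2E a b : (fun w => (G1 w, G2 w)) @^-1` [set (a, b)]
    = (G1 @^-1` [set a]) `&` (G2 @^-1` [set b]).
  by apply/seteqP; split => w /= [-> ->].
have mfiber (Y : {RV P >-> bool}) b : measurable (Y @^-1` [set b]).
  exact: (@measurable_funPTI _ _ _ _ Y [set b]).
rewrite (@probability_preimage_finType _ _ _ P _ X
  (fun x => A x.1.1 x.1.2 x.2)); last first.
  move=> [[a b] c]; rewrite fiberE fiber2E.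
  by apply: measurableI => //; exact: measurableI.
rewrite big_mkcond/= pair_bigA pair_bigA/=.
transitivity (fine (\sum_(x : bool * bool * bool)
  (((if x.1.1 then m1 else 1 - m1) * (if x.1.2 then m2 else 1 - m2)
          * (if x.2 then p else 1 - p)) *+ A x.1.1 x.1.2 x.2)%:E)%E); last first.
  by rewrite sumEFin.
congr fine; apply: eq_bigr => -[[a b] c] _ /=; case: (A a b c) => //.
(* Independence from the pair is used at a single point [(a, b)], which is measurable as a product
   of singletons. *)
rewrite fiberE indepF//; last first.
  have -> : [set (a, b)] = [set a] `*` [set b].
    by apply/seteqP; split => -[? ?] /= [-> ->].
  exact: measurableX.
rewrite fiber2E indepG//.
rewrite (probability_fiber_bool a PG1) (probability_fiber_bool b PG2).
by rewrite (probability_fiber_bool c PF) -!EFinM mulrC.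
Qed.

End TwoSourcesAndCoin.

Arguments fine_probability_sources_coin {R d T P m1 m2 p G1 G2 F}.

Theorem mainTheorem5 (R : realType) (d : measure_display)
    (T : measurableType d) (P : probability T R)
    (m1 m2 : R) (G1 G2 F : {RV P >-> bool})
    (m1_01 : 0 <= m1 <= 1) (m2_01 : 0 <= m2 <= 1) (m1m2_lt1 : m1 * m2 < 1)
    (PG1 : P [set w | G1 w = true] = m1%:E)
    (PG2 : P [set w | G2 w = true] = m2%:E)
    (PF : P [set w | F w = true] = (1 / 2)%:E)
    (indepG : indep_rv P G1 G2)
    (indepF : indep_rv P F (fun w => (G1 w, G2 w))) :
  let E := [set w | (G1 w * G2 w = 0)%N] in
  let bel12 := bel (combined_mass m1 m2) claim in
  let pl12 := pl (combined_mass m1 m2) claim in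
  let betp12 := betp (combined_mass m1 m2) claim in
  [/\ cond_prob P [set w | G1 w = true /\ G2 w = false] E = bel12
        /\ bel12 = m1 * (1 - m2) / (1 - m1 * m2),
      cond_prob P [set w | (G1 w = true /\ G2 w = false) \/
                           (G1 w = false /\ G2 w = false)] E = pl12
        /\ pl12 = 1 - m2 * (1 - m1) / (1 - m1 * m2) &
      cond_prob P [set w | (G1 w = true /\ G2 w = false) \/
                           [/\ G1 w = false, G2 w = false & F w = true]] E
          = betp12
        /\ betp12 = bel12 + (pl12 - bel12) / 2].
Proof.
move=> E bel12 pl12 betp12.
have q0 : 1 - m1 * m2 != 0 by rewrite subr_eq0 eq_sym lt_eqF.
(* Each conditional probability becomes a sum over atoms once its event is coded by a Boolean
   predicate. Conditioning removes the atoms with [a && b], and the remaining ones have total mass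
   [1 - m1 * m2]. *)
have condE (A : bool -> bool -> bool -> bool) (S : set T) :
    (forall w, S w <-> A (G1 w) (G2 w) (F w)) ->
    cond_prob P S E
      = (\sum_(a : bool) \sum_(b : bool) \sum_(c : bool)
          ((if a then m1 else 1 - m1) * (if b then m2 else 1 - m2)
            * (if c then 1 / 2 else 1 - 1 / 2)) *+ (A a b c && ~~ (a && b)))
        / (1 - m1 * m2).
  move=> SA; rewrite /cond_prob.
  have -> : S `&` E
      = [set w | A (G1 w) (G2 w) (F w) && ~~ (G1 w && G2 w)].
    apply/seteqP; split => w /=.
      by move=> [/SA ->]; rewrite /E/=; case: (G1 w); case: (G2 w).
    by case/andP => /SA Sw; rewrite /E/=; case: (G1 w); case: (G2 w).
  have -> : E = [set w | ~~ (G1 w && G2 w)].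
    by apply/seteqP; split => w; rewrite /E/=; case: (G1 w); case: (G2 w).
  rewrite (fine_probability_sources_coin PG1 PG2 PF indepG indepF
    (fun a b c => A a b c && ~~ (a && b))).
  rewrite (fine_probability_sources_coin PG1 PG2 PF indepG indepF
    (fun a b _ => ~~ (a && b))).
  by congr (_ / _); rewrite !big_bool /= !mulr0n !mulr1n; field.
rewrite /bel12 /pl12 /betp12 bel_claimE pl_claimE betp_claimE.
split; split => //.
- rewrite (condE (fun a b _ => a && ~~ b)).
    by rewrite !big_bool /= !mulr0n !mulr1n; congr (_ / _); field.
  by move=> w /=; case: (G1 w); case: (G2 w); split => // -[].
(* The two alternatives of (ii) together say just that source 2 is not decisive. *)
- rewrite (condE (fun _ b _ => ~~ b)).
    by rewrite !big_bool /= !mulr0n !mulr1n; congr (_ / _); field.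
  move=> w /=; case: (G1 w); case: (G2 w).
  - by split => // -[[]|[]].
  - by split => // _; left.
  - by split => // -[[]|[]].
  - by split => // _; right.
- by field.
- rewrite (condE (fun a b c => ~~ b && (a || c))).
    by rewrite !big_bool /= !mulr0n !mulr1n; congr (_ / _); field.
  move=> w /=; case: (G1 w); case: (G2 w); case: (F w).
  (* Cases run through [(G1, G2, F)] with [true] first. These five lie outside the event; of the
     other three, two satisfy the first alternative and the last one the second. *)
  1,2,5,6,8: by split => // -[[]|[]].
  1,2: by split => // _; left.
  by split => // _; right.
- by field.
Qed.
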